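(* Let $\phi:\mathbb{R}^d\to\mathbb{R}$ be bounded below, twice continuously differentiable, with $M$-Lipschitz continuous gradient ($M>0$), and $m$-strongly convex with $0<m\le M$. Let $f:\mathbb{R}^d\to\mathbb{R}$, $g:\mathbb{R}^d\to\mathbb{R}^d$ and constants $\epsilon_f,\epsilon_g\ge 0$ satisfy $|f(x)-\phi(x)|\le\epsilon_f$ and $\|g(x)-\nabla\phi(x)\|\le\epsilon_g$ for all $x\in\mathbb{R}^d$. Let $\{x_k\}$ be generated by the BFGS method with errors (described in the context) with constants $0<c_1<c_2<1$ and lengthening parameter $l>0$ satisfying $l>2\epsilon_g/m$. Fix $q\in(0,1)$, and let $\beta_1$, $A$, $B$ be the constants defined in the context. Let $$\mathcal{N}_1=\left\{x\in\mathbb{R}^d \;:\; \|\nabla\phi(x)\|\le\max\left\{A\frac{\sqrt{M\epsilon_f}}{\beta_1},\ B\frac{\epsilon_g}{\beta_1}\right\}\right\},$$ and let $K=\min\{k\in\mathbb{N}: x_k\in\mathcal{N}_1\}$ (with $K=+\infty$ if no iterate lies in $\mathcal{N}_1$). If in addition $\max\{\epsilon_f,\epsilon_g\}>0$, then $K<+\infty$.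
   Context: $\|\cdot\|$ is the Euclidean norm; $\mathbb{N}=\{0,1,2,\dots\}$. BFGS method with errors. Inputs: $f$, $g$, constants $0<c_1<c_2<1$, lengthening parameter $l>0$, starting point $x_0\in\mathbb{R}^d$, symmetric positive definite $H_0\in\mathbb{R}^{d\times d}$. For $k=0,1,2,\dots$: (1) $p_k=-H_kg(x_k)$. (2) Line search: if there exists $\alpha>0$ such that $f(x_k+\alpha p_k)\le f(x_k)+c_1\alpha p_k^Tg(x_k)$ and $p_k^Tg(x_k+\alpha p_k)\ge c_2p_k^Tg(x_k)$, then $\alpha_k$ is set to some such $\alpha$ (any one of them); otherwise $\alpha_k=0$. (3) If $\|\alpha_kp_k\|\ge l$, set $s_k=\alpha_kp_k$; otherwise set $s_k=l\,p_k/\|p_k\|$. In both cases $y_k=g(x_k+s_k)-g(x_k)$. (4) $H_{k+1}=(I-\rho_ks_ky_k^T)H_k(I-\rho_ky_ks_k^T)+\rho_ks_ks_k^T$ with $\rho_k=1/(s_k^Ty_k)$. (5) $x_{k+1}=x_k+\alpha_kp_k$. It is understood that $g(x_k)\ne0$ for all $k$, so that all steps are defined. Constants: $B_0=H_0^{-1}$, $\widehat m=m-2\epsilon_g/l$, $\widehat M=M+2\epsilon_g/l$, $$\beta_0=\frac{1}{1-q}\left[\mathrm{tr}(B_0)-\log\det(B_0)+\widehat M-1-\log\widehat m\right],\qquad \beta_1=e^{-\beta_0/2}\in(0,1),$$ $$A=\max\left\{\frac{16\sqrt2}{\sqrt{(c_2-c_1)(4-c_1-3c_2)}},\ \frac{8}{\sqrt{c_1(1-c_2)}}\right\},\qquad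 B=\max\left\{\frac{8}{1-c_2},\ \frac{8(1+c_1)}{c_2-c_1}+6\right\}.$$ *)

(* Defs.v *)
From mathcomp Require Import all_boot all_order all_algebra.
From mathcomp Require Import all_classical all_reals all_analysis.

Set Implicit Arguments.
Unset Strict Implicit.
Unset Printing Implicit Defensive.

Import Order.TTheory GRing.Theory Num.Theory.
Import numFieldNormedType.Exports.

Local Open Scope classical_set_scope.
Local Open Scope ring_scope.

Definition dot {R : realType} {d : nat} (u v : 'cV[R]_d) : R :=
  (u^T *m v) 0 0.

(* The library norm `|u| on matrices is the sup norm; it induces the same
   topology (hence the same notions of derivative and continuity) as the
   Euclidean norm, but metric hypotheses need the latter. *)
Definition enorm {R : realType} {d : nat} (u : 'cV[R]_d) : R :=
  Num.sqrt (dot u u).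

Definition gradient {R : realType} {d : nat} (phi : 'cV[R]_d -> R)
    (x : 'cV[R]_d) : 'cV[R]_d :=
  \col_i 'D_(delta_mx i 0) phi x.

Definition hessian {R : realType} {d : nat} (phi : 'cV[R]_d -> R)
    (x : 'cV[R]_d) : 'M[R]_d :=
  \matrix_(i, j) 'D_(delta_mx i 0) (fun z => gradient phi z j 0) x.

(* [differentiable] is Frechet differentiability. *)
Definition twice_continuously_differentiable {R : realType} {d : nat}
    (phi : 'cV[R]_d -> R) : Prop :=
  [/\ forall x, differentiable phi x,
      forall x, differentiable (gradient phi) x
    & continuous (hessian phi)].

Definition elipschitz {R : realType} {d : nat} (L : R)
    (F : 'cV[R]_d -> 'cV[R]_d) : Prop :=
  forall x y, enorm (F x - F y) <= L * enorm (x - y).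

Definition strongly_convex {R : realType} {d : nat} (m : R)
    (phi : 'cV[R]_d -> R) : Prop :=
  forall (x y : 'cV[R]_d) (t : R), 0 <= t -> t <= 1 ->
    phi (t *: x + (1 - t) *: y) <=
      t * phi x + (1 - t) * phi y
      - m / 2 * t * (1 - t) * enorm (x - y) ^+ 2.

Definition sym_posdef {R : realType} {d : nat} (H : 'M[R]_d) : Prop :=
  H^T = H /\ forall v : 'cV[R]_d, v != 0 -> 0 < dot v (H *m v).

Definition armijo_wolfe {R : realType} {d : nat} (f : 'cV[R]_d -> R)
    (g : 'cV[R]_d -> 'cV[R]_d) (c1 c2 : R) (x p : 'cV[R]_d) (a : R) : Prop :=
  [/\ 0 < a,
      f (x + a *: p) <= f x + c1 * a * dot p (g x)
    & dot p (g (x + a *: p)) >= c2 * dot p (g x)].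

Definition line_search {R : realType} {d : nat} (f : 'cV[R]_d -> R)
    (g : 'cV[R]_d -> 'cV[R]_d) (c1 c2 : R) (x p : 'cV[R]_d) (a : R) : Prop :=
  armijo_wolfe f g c1 c2 x p a \/
  (~ (exists a', armijo_wolfe f g c1 c2 x p a') /\ a = 0).

Definition lengthened_step {R : realType} {d : nat} (l a : R)
    (p : 'cV[R]_d) : 'cV[R]_d :=
  if l <= enorm (a *: p) then a *: p else (l / enorm p) *: p.

Definition bfgs_update {R : realType} {d : nat} (H : 'M[R]_d)
    (s y : 'cV[R]_d) : 'M[R]_d :=
  let rho := (dot s y)^-1 in
  (1%:M - rho *: (s *m y^T)) *m H *m (1%:M - rho *: (y *m s^T))
  + rho *: (s *m s^T).

(* The line search may return any admissible step length, so the method is a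
   relation on its traces rather than a function of the inputs. *)
Record bfgs_trace {R : realType} {d : nat} (f : 'cV[R]_d -> R)
    (g : 'cV[R]_d -> 'cV[R]_d) (c1 c2 l : R) (x0 : 'cV[R]_d) (H0 : 'M[R]_d)
    (x p s y : nat -> 'cV[R]_d) (alpha : nat -> R) (H : nat -> 'M[R]_d) :
    Prop := BfgsTrace {
  bfgs_x0 : x 0%N = x0;
  bfgs_H0 : H 0%N = H0;
  bfgs_g_neq0 : forall k, g (x k) != 0;
  bfgs_dir : forall k, p k = - (H k *m g (x k));
  bfgs_alpha : forall k, line_search f g c1 c2 (x k) (p k) (alpha k);
  bfgs_s : forall k, s k = lengthened_step l (alpha k) (p k);
  bfgs_y : forall k, y k = g (x k + s k) - g (x k);
  bfgs_H : forall k, H k.+1 = bfgs_update (H k) (s k) (y k);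
  bfgs_x : forall k, x k.+1 = x k + alpha k *: p k
}.

Definition m_hat {R : realType} (m eps_g l : R) : R := m - 2 * eps_g / l.

Definition M_hat {R : realType} (M eps_g l : R) : R := M + 2 * eps_g / l.

Definition beta0 {R : realType} {d : nat} (m M eps_g l q : R)
    (H0 : 'M[R]_d) : R :=
  (1 - q)^-1 * (\tr (invmx H0) - ln (\det (invmx H0))
                + M_hat M eps_g l - 1 - ln (m_hat m eps_g l)).

Definition beta1 {R : realType} {d : nat} (m M eps_g l q : R)
    (H0 : 'M[R]_d) : R :=
  expR (- beta0 m M eps_g l q H0 / 2).

Definition constA {R : realType} (c1 c2 : R) : R :=
  Num.max (16 * Num.sqrt 2 / Num.sqrt ((c2 - c1) * (4 - c1 - 3 * c2)))
          (8 / Num.sqrt (c1 * (1 - c2))).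

Definition constB {R : realType} (c1 c2 : R) : R :=
  Num.max (8 / (1 - c2)) (8 * (1 + c1) / (c2 - c1) + 6).

Definition N1 {R : realType} {d : nat} (phi : 'cV[R]_d -> R)
    (m M eps_f eps_g c1 c2 l q : R) (H0 : 'M[R]_d) : set 'cV[R]_d :=
  [set x | enorm (gradient phi x) <=
    Num.max (constA c1 c2 * (Num.sqrt (M * eps_f) / beta1 m M eps_g l q H0))
            (constB c1 c2 * (eps_g / beta1 m M eps_g l q H0))].

(* For a nonempty set of natural numbers the infimum is its minimum, and the
   infimum of the empty set is +oo. *)
Definition hitting_time {R : realType} {T : Type} (x : nat -> T)
    (N : set T) : \bar R :=
  ereal_inf [set (k%:R)%:E | k in [set k | N (x k)]].

(* Main.v *)
Require Import Defs.
From mathcomp Require Import all_boot all_order all_algebra.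
From mathcomp Require Import all_classical all_reals all_analysis.
From mathcomp Require Import ring lra.
Import Order.TTheory GRing.Theory Num.Theory.
Import numFieldNormedType.Exports.
Local Open Scope classical_set_scope.
Local Open Scope ring_scope.

(* Along the method the potential [\tr B - ln (\det B)], with [B] the inverse of
   [H], is bounded below by the dimension. Lengthening makes every pair [(s, y)]
   satisfy the curvature bounds [m_hat |s|^2 <= s.y] and [|y|^2 <= M_hat s.y], so
   a step raises the potential by at most
   [M_hat - 1 - ln m_hat + ln (cos^2 theta)], where [theta] is the angle between
   [p] and [- g x]. Hence [cos theta >= beta1] infinitely often. At such an
   iterate outside [N1] the noise is too small to spoil an exact solution [a] of
   [p.grad phi (x + a p) = (c1 + 3 c2) / 4 * p.grad phi x], so the line search
   succeeds, and the curvature condition then bounds the decrease of [f] below by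
   a fixed positive amount. As [f] never increases along the iterates and is
   bounded below, some iterate must lie in [N1]. *)

(** * Euclidean inner product and norm *)

Section Dot.
Local Set Implicit Arguments.
Local Unset Strict Implicit.
Context {R : realType} {d : nat}.
Implicit Types (u v w : 'cV[R]_d) (a b : R).

Lemma dotE u v : dot u v = \sum_i u i 0 * v i 0.
Proof. by rewrite /dot mxE; apply: eq_bigr => i _; rewrite mxE. Qed.

Lemma dotC u v : dot u v = dot v u.
Proof. by rewrite !dotE; apply: eq_bigr => i _; rewrite mulrC. Qed.

Lemma dotDl u v w : dot (u + v) w = dot u w + dot v w.
Proof. by rewrite /dot linearD mulmxDl mxE. Qed.

Lemma dotDr u v w : dot w (u + v) = dot w u + dot w v.
Proof. by rewrite !(dotC w) dotDl. Qed.

Lemma dotZl a u v : dot (a *: u) v = a * dot u v.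
Proof. by rewrite /dot linearZ -scalemxAl mxE. Qed.

Lemma dotZr a u v : dot u (a *: v) = a * dot u v.
Proof. by rewrite !(dotC u) dotZl. Qed.

Lemma dotNl u v : dot (- u) v = - dot u v.
Proof. by rewrite -scaleN1r dotZl mulN1r. Qed.

Lemma dotNr u v : dot u (- v) = - dot u v.
Proof. by rewrite -scaleN1r dotZr mulN1r. Qed.

Lemma dot0l u : dot 0 u = 0.
Proof. by rewrite -(scale0r 0) dotZl mul0r. Qed.

Lemma dot0r u : dot u 0 = 0.
Proof. by rewrite dotC dot0l. Qed.

Definition dotlin := (dotDl, dotDr, dotNl, dotNr, dotZl, dotZr).

Lemma dot_mulmxl (A : 'M[R]_d) u v : dot (A *m u) v = dot u (A^T *m v).
Proof. by rewrite /dot trmx_mul mulmxA. Qed.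

Lemma rank1_mulmx u v w : (u *m v^T) *m w = dot v w *: u.
Proof.
by rewrite -mulmxA [v^T *m w]mx11_scalar mul_mx_scalar.
Qed.

Lemma mxtrace_rank1 u v : \tr (u *m v^T) = dot v u.
Proof. by rewrite mxtrace_mulC /mxtrace big_ord_recl big_ord0 addr0. Qed.

Lemma dot_ge0 u : 0 <= dot u u.
Proof. by rewrite dotE; apply: sumr_ge0 => i _; rewrite -expr2 sqr_ge0. Qed.

Lemma dot_gt0 u : u != 0 -> 0 < dot u u.
Proof.
move=> u0; rewrite lt_neqAle dot_ge0 andbT eq_sym; apply: contra u0.
rewrite dotE psumr_eq0 => [/allP u0|i _]; last by rewrite -expr2 sqr_ge0.
apply/eqP/colP => i; rewrite mxE; apply/eqP.
by have := u0 i (mem_index_enum _); rewrite /= mulf_eq0 orbb.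
Qed.

Lemma enorm_ge0 u : 0 <= enorm u. Proof. exact: sqrtr_ge0. Qed.

Lemma enorm_gt0 u : u != 0 -> 0 < enorm u.
Proof. by move=> u0; rewrite sqrtr_gt0 dot_gt0. Qed.

Lemma sqr_enorm u : enorm u ^+ 2 = dot u u.
Proof. by rewrite sqr_sqrtr ?dot_ge0. Qed.

Lemma enormZ a u : enorm (a *: u) = `|a| * enorm u.
Proof.
by rewrite /enorm !dotlin mulrA -expr2 sqrtrM ?sqr_ge0 // sqrtr_sqr.
Qed.

Lemma enorm_le u b : 0 <= b -> dot u u <= b ^+ 2 -> enorm u <= b.
Proof.
by move=> b0 h; rewrite -(ler_pXn2r (ltn0Sn 1)) ?nnegrE ?enorm_ge0 ?sqr_enorm.
Qed.

Lemma dot_le_enorm u v : dot u v <= enorm u * enorm v.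
Proof.
have [->|u0] := eqVneq u 0.
  by rewrite dot0l /enorm dot0l sqrtr0 mul0r.
apply: le_trans (ler_norm _) _.
rewrite -(ler_pXn2r (ltn0Sn 1)) ?nnegrE ?mulr_ge0 ?enorm_ge0 //.
rewrite real_normK ?num_real // exprMn !sqr_enorm.
have uu := dot_gt0 u0.
(* This vector is [dot u u] times the component of [v] orthogonal to [u]; its square is [dot u u]
   times the gap in the squared inequality. *)
have := dot_ge0 (dot u u *: v - dot u v *: u).
rewrite !dotlin (dotC v u) => h.
rewrite -subr_ge0 -(pmulr_rge0 _ uu).
by apply: le_trans h _; rewrite le_eqVlt; apply/orP; left; apply/eqP; ring.
Qed.

Lemma dot_ge_enorm u v : - (enorm u * enorm v) <= dot u v.
Proof.
by rewrite lerNl -dotNl; apply: le_trans (dot_le_enorm _ _) _;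
  rewrite -scaleN1r enormZ normrN1 mul1r.
Qed.

Lemma enormD u v : enorm (u + v) <= enorm u + enorm v.
Proof.
apply: enorm_le; first by rewrite addr_ge0 ?enorm_ge0.
rewrite sqrrD !sqr_enorm !dotlin (dotC v u).
by have := dot_le_enorm u v; lra.
Qed.

Lemma enormB_sym u v : enorm (u - v) = enorm (v - u).
Proof. by rewrite -opprB -scaleN1r enormZ normrN1 mul1r. Qed.

End Dot.

(** * Trace and determinant of positive definite matrices *)

Section PosDef.
Local Set Implicit Arguments.
Local Unset Strict Implicit.
Context {R : realType}.

(** One block matrix is factored in two ways; its determinant is that of either Schur complement,
    one of size [d] and one of size 1. *)
Lemma det_rank1_update {d} (u v : 'cV[R]_d) :
  \det (1%:M + u *m v^T) = 1 + dot v u.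
Proof.
have h1 : block_mx 1%:M u (- v^T) 1%:M =
   block_mx (1%:M + u *m v^T) u 0 1%:M *m block_mx 1%:M 0 (- v^T) (1%:M : 'M[R]_1).
  rewrite mulmx_block ?mulmx1 ?mulmx0 ?mul0mx ?mul1mx ?add0r.
  by rewrite mulmxN addrK.
have h2 : block_mx 1%:M u (- v^T) 1%:M =
   block_mx 1%:M 0 (- v^T) (1%:M : 'M[R]_1) *m block_mx 1%:M u 0 (1%:M + v^T *m u).
  rewrite mulmx_block ?mulmx1 ?mulmx0 ?mul0mx ?mul1mx ?addr0.
  by rewrite mulNmx addrCA addNr addr0.
have := congr1 determinant (etrans (esym h1) h2).
rewrite !det_mulmx !det_ublock !det_lblock !det1 !mulr1 !mul1r => ->.
by rewrite det_mx11 mxE [1%:M 0 0]mxE eqxx.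
Qed.

(* Induction on the dimension through the Schur complement [S] of the corner
   entry [a]: [\det B = a * \det S] and [\tr S <= \tr B - a]. *)
Lemma sym_posdef_trace_ln_det d (B : 'M[R]_d) :
  sym_posdef B -> 0 < \det B /\ d%:R <= \tr B - ln (\det B).
Proof.
elim: d B => [|d IH] B [BT Bpos].
  by rewrite det_mx00 ln1 /mxtrace big_ord0 subrr; split.
have [a [v [C EB]]] : exists (a : R) (v : 'cV_d) (C : 'M[R]_d),
    B = block_mx (a%:M : 'M[R]_1) v^T v C.
  exists ((@ulsubmx _ 1 d 1 d B) 0 0), (@dlsubmx _ 1 d 1 d B), (@drsubmx _ 1 d 1 d B).
  rewrite -mx11_scalar trmx_dlsub -{1}(@submxK _ 1 d 1 d B) BT //.
subst B.
have CT : C^T = C.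
  by move: BT; rewrite (@tr_block_mx _ 1 d 1 d) => /(@eq_block_mx _ 1 d 1 d) [].
have quad (t : R) (w : 'cV_d) :
    dot (@col_mx _ 1 d 1 t%:M w) (block_mx a%:M v^T v C *m @col_mx _ 1 d 1 t%:M w)
    = a * t ^+ 2 + 2 * t * dot v w + dot w (C *m w).
  rewrite (@mul_block_col _ 1 d 1 d 1) /dot (@tr_col_mx _ 1 d 1).
  rewrite (@mul_row_col _ 1 1 d 1).
  rewrite tr_scalar_mx mul_scalar_mx !mul_mx_scalar mulmxDr -scalemxAr.
  rewrite [LHS]mxE [X in X + _]mxE [X in _ * X]mxE [X in _ + X]mxE.
  rewrite [X in _ * (X + _)]mxE.
  rewrite [a%:M 0 0]mxE eqxx mulr1n [X in _ + (X + _)]mxE.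
  rewrite -[(v^T *m w) 0 0]/(dot v w) -[(w^T *m v) 0 0]/(dot w v) (dotC w v); ring.
have a0 : 0 < a.
  have := Bpos (@col_mx _ 1 d 1 1%:M 0).
  rewrite quad dot0r dot0l mulr0 !addr0 expr1n mulr1; apply; apply/eqP.
  rewrite -(@col_mx0 _ 1 d 1) => /(@eq_col_mx _ 1 d 1) [/matrixP /(_ 0 0)].
  by rewrite !mxE => /eqP; rewrite oner_eq0.
pose S := C - a^-1 *: (v *m v^T).
have SP : sym_posdef S.
  split; first by rewrite /S linearB linearZ /= trmx_mul trmxK CT.
  (* For fixed [w] this first coordinate minimizes the quadratic form of the block matrix, and the
     minimum is the quadratic form of [S]. *)
  move=> w w0; have := Bpos (@col_mx _ 1 d 1 (- dot v w / a)%:M w).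
  rewrite quad => h.
  have -> : dot w (S *m w) =
      a * (- dot v w / a) ^+ 2 + 2 * (- dot v w / a) * dot v w + dot w (C *m w).
    rewrite mulmxBl -scalemxAl rank1_mulmx !dotlin (dotC w v); field.
    by rewrite gt_eqF.
  apply: h; apply/eqP => h0.
  move: h0; rewrite -(@col_mx0 _ 1 d 1) => /(@eq_col_mx _ 1 d 1) [_ /eqP].
  by rewrite (negPf w0).
have [dS tS] := IH S SP.
have detB : \det (block_mx (a%:M : 'M[R]_1) v^T v C) = a * \det S.
  have -> : block_mx (a%:M : 'M[R]_1) v^T v C =
     block_mx 1%:M 0 (a^-1 *: v) 1%:M *m block_mx a%:M v^T 0 S.
    rewrite mulmx_block ?mul1mx ?mul0mx !addr0 mul_mx_scalar.
    by rewrite scalerA mulfV ?gt_eqF // scale1r -scalemxAl addrC subrK.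
  by rewrite det_mulmx det_lblock det_ublock !det1 !mul1r det_scalar1.
split; first by rewrite detB mulr_gt0.
rewrite detB lnM ?posrE // (@mxtrace_block _ 1 d) mxtrace_scalar mulr1n.
have trS : \tr S = \tr C - a^-1 * dot v v.
  by rewrite /S linearB linearZ /= mxtrace_rank1.
have vv : 0 <= a^-1 * dot v v by rewrite mulr_ge0 ?dot_ge0 // invr_ge0 ltW.
(* The corner contributes [a - ln a >= 1], which pays for the extra dimension. *)
have la : ln a <= a - 1.
  by have := @le_ln1Dx R (a - 1); rewrite addrCA subrr addr0; apply; lra.
rewrite -natr1; lra.
Qed.

End PosDef.

(** * The BFGS update of the inverse matrix and its potential *)

Section Update.
Local Set Implicit Arguments.
Local Unset Strict Implicit.
Context {R : realType} {d : nat}.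
Implicit Types (B H F : 'M[R]_d) (s y u v : 'cV[R]_d).

Lemma rank1E u v i j : (u *m v^T) i j = u i 0 * v j 0.
Proof. by rewrite mxE big_ord_recl big_ord0 addr0 !mxE !ord1. Qed.

Lemma trmx_rank1 u v : (u *m v^T)^T = v *m u^T.
Proof. by rewrite trmx_mul trmxK. Qed.

Lemma sym_posdef_congr B F :
  F \in unitmx -> sym_posdef B -> sym_posdef (F *m B *m F^T).
Proof.
move=> Fu [BT Bpos]; split; first by rewrite !trmx_mul trmxK BT mulmxA.
move=> v v0; rewrite -!mulmxA -{1}(trmxK F) -dot_mulmxl; apply: Bpos.
apply: contraNneq v0 => h.
by rewrite -(mulKmx (_ : F^T \in unitmx) v) ?unitmx_tr // h mulmx0.
Qed.

(** Congruence of [B] by its inverse gives the transpose of the inverse, which is therefore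
    symmetric and equal to the inverse itself. *)
Lemma sym_posdef_invmx B : sym_posdef B -> sym_posdef (invmx B).
Proof.
move=> BP; have [dB _] := sym_posdef_trace_ln_det BP.
have Bu : B \in unitmx by rewrite unitmxE unitfE gt_eqF.
have := sym_posdef_congr (F := invmx B) _ BP.
rewrite unitmx_inv mulVmx // mul1mx => /(_ Bu) [ST Spos].
by rewrite trmxK in ST; rewrite -ST in Spos; split => //; rewrite -ST.
Qed.

(** The direct BFGS formula: the same update written for the inverse [B] of [H], whose trace and
    determinant are easy to follow. *)
Definition bfgs_update_inv B s y : 'M[R]_d :=
  B - (dot s (B *m s))^-1 *: ((B *m s) *m (B *m s)^T) + (dot s y)^-1 *: (y *m y^T).

(** By the secant equation [s^T *m B' = y^T], the right factor of the update strips from [B'] its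
    last rank-one term; [H *m B = 1%:M] then reduces the rest to rank-one terms that cancel. *)
Lemma bfgs_update_invP H B s y : B^T = B -> H *m B = 1%:M ->
  dot s y != 0 -> dot s (B *m s) != 0 ->
  bfgs_update H s y *m bfgs_update_inv B s y = 1%:M.
Proof.
move=> BT HB sy0 sb0; set B' := bfgs_update_inv B s y.
have sB' : s^T *m B' = y^T.
  apply: trmx_inj; rewrite trmx_mul !trmxK.
  rewrite /B' /bfgs_update_inv linearD /= linearB /= !linearZ /= !trmx_rank1.
  rewrite BT !mulmxDl.
  rewrite -!scalemxAl mulNmx !rank1_mulmx scalerN.
  by rewrite !scalerA (dotC y) (dotC (B *m s)) !mulVf // !scale1r subrr add0r.
have VB' : (1%:M - (dot s y)^-1 *: (y *m s^T)) *m B' =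
    B - (dot s (B *m s))^-1 *: ((B *m s) *m (B *m s)^T).
  rewrite mulmxBl mul1mx -scalemxAl -[y *m s^T *m _]mulmxA sB'.
  by rewrite {1}/B' /bfgs_update_inv addrK.
rewrite /bfgs_update; set V := 1%:M - _; set W := 1%:M - _ in VB' *.
rewrite mulmxDl -(mulmxA _ W) VB' -scalemxAl -(mulmxA s) sB'.
rewrite -mulmxA mulmxBr HB -scalemxAr !mulmxA HB mul1mx.
rewrite mulmxBr mulmx1 /V -scalemxAr mulmxBl mul1mx -scalemxAl.
have -> : s *m y^T *m (s *m (B *m s)^T) = dot s y *: (s *m (B *m s)^T).
  by rewrite mulmxA rank1_mulmx -scalemxAl dotC.
by rewrite scalerA mulVf // scale1r subrr scaler0 subr0 subrK.
Qed.

(* The update is the congruence [F *m B *m F^T] by the rank-one perturbation [F]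
   of the identity introduced below, whose determinant [c] satisfies
   [c ^+ 2 = s.y / s.Bs]. *)
Lemma bfgs_update_inv_posdef B s y :
  sym_posdef B -> 0 < dot s y -> 0 < dot s (B *m s) ->
  sym_posdef (bfgs_update_inv B s y) /\
  \det (bfgs_update_inv B s y) = dot s y / dot s (B *m s) * \det B.
Proof.
move=> BP sy0 sb0; have [BT _] := BP.
set b := B *m s; set c := Num.sqrt (dot s y / dot s b).
have c2 : c ^+ 2 = dot s y / dot s b by rewrite sqr_sqrtr // divr_ge0 ?ltW.
have c0 : 0 < c by rewrite sqrtr_gt0 divr_gt0.
have sbE : dot s b = dot s y / c ^+ 2 by rewrite c2; field; rewrite !gt_eqF.
pose u := (c / dot s y) *: (y - c *: b).
pose F := 1%:M + u *m s^T.
have detF : \det F = c.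
  by rewrite det_rank1_update !dotlin sbE; field; rewrite !gt_eqF.
have FE : bfgs_update_inv B s y = F *m B *m F^T.
  rewrite /F linearD /= trmx1 trmx_rank1 mulmxDl mul1mx mulmxDr mulmx1.
  have -> : u *m s^T *m B = u *m b^T by rewrite -mulmxA /b trmx_mul BT.
  rewrite mulmxDl mulmxA -/b [u *m b^T *m _]mulmxA rank1_mulmx (dotC b) -scalemxAl.
  apply/matrixP => i j; rewrite /bfgs_update_inv -/b.
  have ED n k l (X Y : 'M[R]_(d, n)) : (X + Y) k l = X k l + Y k l.
    by rewrite mxE.
  have EZ n k l a (X : 'M[R]_(d, n)) : (a *: X) k l = a * X k l by rewrite mxE.
  have EN n k l (X : 'M[R]_(d, n)) : (- X) k l = - X k l by rewrite mxE.
  by rewrite /u !(ED, EN, EZ, rank1E) sbE; field; rewrite !gt_eqF.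
split; last by rewrite FE !det_mulmx det_tr detF -c2; ring.
by rewrite FE; apply: sym_posdef_congr; rewrite // unitmxE unitfE detF gt_eqF.
Qed.

Lemma mxtrace_bfgs_update_inv B s y :
  \tr (bfgs_update_inv B s y) =
  \tr B - dot (B *m s) (B *m s) / dot s (B *m s) + dot y y / dot s y.
Proof.
rewrite /bfgs_update_inv -scaleNr !mxtraceD !mxtraceZ !mxtrace_rank1.
by rewrite mulNr ![_^-1 * _]mulrC.
Qed.

(* The last term is the logarithm of the squared cosine of the angle between
   [s] and [B s]. *)
Lemma bfgs_update_inv_trace_ln_det (mh Mh : R) B s y :
  sym_posdef B -> s != 0 -> 0 < mh ->
  mh * dot s s <= dot s y -> dot y y <= Mh * dot s y ->
  \tr (bfgs_update_inv B s y) - ln (\det (bfgs_update_inv B s y)) <=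
  \tr B - ln (\det B) + (Mh - 1 - ln mh) +
  ln (dot s (B *m s) ^+ 2 / (dot s s * dot (B *m s) (B *m s))).
Proof.
move=> BP s0 mh0 hm hM; have [_ Bpos] := BP.
have [dB _] := sym_posdef_trace_ln_det BP.
have ss := dot_gt0 s0; have sb := Bpos _ s0.
have sy : 0 < dot s y by apply: lt_le_trans hm; rewrite mulr_gt0.
have [_ ->] := bfgs_update_inv_posdef BP sy sb.
rewrite mxtrace_bfgs_update_inv.
have b0 : B *m s != 0 by apply: contraTneq sb => ->; rewrite dot0r ltxx.
have bb := dot_gt0 b0.
set b := B *m s in sb b0 bb *.
rewrite lnM ?posrE ?divr_gt0 // ln_div ?posrE // ln_div ?posrE ?mulr_gt0 ?exprn_gt0 //.
rewrite lnM ?posrE // lnXn // mulr2n.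
have h1 : ln mh + ln (dot s s) <= ln (dot s y).
  by rewrite -lnM ?posrE // ler_ln ?posrE ?mulr_gt0.
have h2 : dot y y / dot s y <= Mh by rewrite ler_pdivrMr.
(* The trace loses exactly [dot b b / dot s b]; trading this for its logarithm produces the cosine
   and the constant -1. *)
have h3 : ln (dot b b) - ln (dot s b) <= dot b b / dot s b - 1.
  rewrite -ln_div ?posrE //; have := @le_ln1Dx R (dot b b / dot s b - 1).
  by rewrite addrCA subrr addr0; apply; rewrite ltrBrDl subrr divr_gt0.
lra.
Qed.

End Update.

(** * Quadratic bounds for [phi], exact step lengths and noisy secant pairs *)

Section Smooth.
Local Set Implicit Arguments.
Local Unset Strict Implicit.
Context {R : realType} {d : nat} {phi : 'cV[R]_d -> R} {m M : R}.
Hypothesis phi_diff : forall x, differentiable phi x.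
Hypothesis m_gt0 : 0 < m.
Hypothesis m_le_M : m <= M.
Hypothesis phi_lip : elipschitz M (gradient phi).
Hypothesis phi_conv : strongly_convex m phi.
Implicit Types (x y z w p s : 'cV[R]_d).
Local Notation G := (gradient phi).

Lemma derive_dot_gradient z w : 'D_w phi z = dot (G z) w.
Proof.
rewrite deriveE // {1}(matrix_sum_delta w) linear_sum dotE.
apply: eq_bigr => i _; rewrite big_ord_recl big_ord0 addr0.
by rewrite linearZ /= mxE deriveE // mulrC ord1.
Qed.

Lemma is_derive_line z w (t : R) :
  is_derive t 1 (fun t => phi (z + t *: w)) (dot (G (z + t *: w)) w).
Proof.
rewrite -derive_dot_gradient.
(* Both difference quotients are the same function of [h], so existence and value of the directional
   derivative carry over to the line. *)
have E : (fun h : R =>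
      h^-1 *: ((phi \o shift (z + t *: w)) (h *: w) - phi (z + t *: w))) =
    (fun h : R => h^-1 *:
      (((fun t => phi (z + t *: w)) \o shift t) (h *: 1) - phi (z + t *: w))).
  apply/funext => h /=; congr (_ *: (phi _ - _)).
  by rewrite [h *: 1]mulr1 scalerDl addrCA.
split; last by rewrite /derive E.
by have := @diff_derivable _ _ _ phi (z + t *: w) w (phi_diff _); rewrite /derivable E.
Qed.

(** Mean value theorem on a segment after subtracting a parabola. With [a = M] or [a = - M] the
    parabola offsets the variation of the gradient, which yields quadratic bounds with constant 1/2
    without integration. *)
Lemma gradient_mvt (a : R) z w : exists2 c : R, 0 < c < 1 &
  phi (z + w) - phi z - a / 2 * dot w w = dot (G (z + c *: w)) w - a * c * dot w w.
Proof.
pose F (t : R) := phi (z + t *: w) - a / 2 * dot w w * t ^+ 2.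
have dF (t : R) : is_derive t (1 : R) F (dot (G (z + t *: w)) w - a * t * dot w w).
  have h1 := is_derive_line z w t.
  apply: is_derive_eq.
  by rewrite /GRing.scale /=; field.
have [|c] := @MVT R F _ 0 1 ltr01 (fun t _ => dF t).
  apply: derivable_within_continuous => t _; exact: (@ex_derive _ _ _ _ _ _ _ (dF t)).
rewrite in_itv /= => c01; rewrite subr0 mulr1 /= => E; exists c => //; rewrite -E.
rewrite /F scale1r scale0r addr0; ring.
Qed.

Let M_ge0 : 0 <= M. Proof. exact: le_trans (ltW m_gt0) m_le_M. Qed.

Lemma gradient_diff_bound z w (c : R) : 0 <= c ->
  `|dot (G (z + c *: w) - G z) w| <= M * c * dot w w.
Proof.
move=> c0.
have h : enorm (G (z + c *: w) - G z) * enorm w <= M * c * dot w w.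
  have := phi_lip (z + c *: w) z; rewrite addrAC subrr add0r enormZ ger0_norm // => h.
  rewrite -sqr_enorm expr2 mulrA ler_wpM2r ?enorm_ge0 //.
  by rewrite -mulrA.
rewrite ler_norml (le_trans _ (dot_ge_enorm _ _)) ?lerN2 //.
exact: le_trans (dot_le_enorm _ _) h.
Qed.

Lemma descent_upper z w : phi (z + w) <= phi z + dot (G z) w + M / 2 * dot w w.
Proof.
have [c /andP[c0 _] h] := gradient_mvt M z w.
have := gradient_diff_bound z w (ltW c0).
by rewrite ler_norml dotDl dotNl => /andP[_ h2]; lra.
Qed.

Lemma descent_lower z w : phi z + dot (G z) w - M / 2 * dot w w <= phi (z + w).
Proof.
have [c /andP[c0 _] h] := gradient_mvt (- M) z w.
have := gradient_diff_bound z w (ltW c0).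
by rewrite ler_norml dotDl dotNl => /andP[h2 _]; lra.
Qed.

(** Strong convexity at [z + t *: w], combined with [descent_lower] and divided by [t], leaves an
    error of order [t], where [t] may be taken arbitrarily small. *)
Lemma strong_convexity_lower z w :
  phi z + dot (G z) w + m / 2 * dot w w <= phi (z + w).
Proof.
have ww := dot_ge0 w.
have key (t : R) : 0 < t -> t < 1 ->
    dot (G z) w + m / 2 * dot w w + phi z - phi (z + w) <= t * ((M + m) / 2 * dot w w).
  move=> t0 t1; have := phi_conv (z + w) z (ltW t0) (ltW t1).
  rewrite [z + w - z]addrAC subrr add0r sqr_enorm.
  have -> : t *: (z + w) + (1 - t) *: z = z + t *: w.
    by apply/colP => i; rewrite !mxE; ring.
  have := descent_lower z (t *: w); rewrite !dotlin => h1 h2.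
  rewrite -(ler_pM2l t0); nra.
rewrite -subr_le0; apply/ler_addgt0Pr => e e0; rewrite add0r.
pose K := (M + m) / 2 * dot w w.
have K0 : 0 <= K by rewrite mulr_ge0 // divr_ge0 // addr_ge0 // ltW.
(* Small enough for [t * K <= e], while the summand [e + 1] keeps [t] below 1 even if [K = 0]. *)
pose t := e / (K + e + 1).
have D0 : 0 < K + e + 1 by lra.
have t0 : 0 < t by rewrite divr_gt0.
have t1 : t < 1 by rewrite ltr_pdivrMr // mul1r; lra.
have := key t t0 t1; rewrite -/K => h.
have : t * K <= e by rewrite mulrAC ler_pdivrMr // ler_wpM2l ?ltW //; lra.
lra.
Qed.

Lemma gradient_strongly_monotone z w :
  m * dot w w <= dot (G (z + w) - G z) w.
Proof.
have := strong_convexity_lower z w.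
have := strong_convexity_lower (z + w) (- w).
rewrite addrK !dotlin; lra.
Qed.

(** Cocoercivity of the gradient of [phi] minus [m / 2] times the squared norm. It follows by
    comparing the upper and lower quadratic bounds for [phi] at [x - t *: D] and at [y + t *: D]. *)
Lemma gradient_cocoercive x y :
  let D := G x - G y - m *: (x - y) in
  dot D D <= (M - m) * dot D (x - y).
Proof.
rewrite /=; set s := x - y; set D := _ - m *: s.
have Dx : G x = D + m *: s + G y by rewrite /D subrK subrK.
have key (t : R) : 2 * t * dot D D <= dot D s + (M - m) * t ^+ 2 * dot D D.
  have h1 := descent_upper x (- (t *: D)).
  have h2 := descent_upper y (t *: D).
  have h3 := strong_convexity_lower y (s - t *: D).
  have h4 := strong_convexity_lower x (- (s - t *: D)).
  have E1 : y + (s - t *: D) = x - t *: D by rewrite addrA (addrC y) subrK.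
  have E2 : x - (s - t *: D) = y + t *: D by rewrite opprB addrCA opprB subrKC addrC.
  rewrite E1 in h3; rewrite E2 in h4.
  clearbody D s; move: h1 h2 h3 h4; rewrite Dx !dotlin (dotC s D) => h1 h2 h3 h4.
  nra.
have DD := dot_ge0 D.
(* The choice [t = (M - m)^-1] is the best one in [key]; if [M = m] the quadratic term vanishes and
   a large [t] rules out [D != 0]. *)
have [L0|L0] := ltP m M.
  have L1 : 0 < M - m by lra.
  have := key (M - m)^-1; rewrite -(ler_pM2l L1) => h.
  have E1 : (M - m) * (2 * (M - m)^-1 * dot D D) = 2 * dot D D by field; rewrite gt_eqF.
  have E2 : (M - m) * (dot D s + (M - m) * (M - m)^-1 ^+ 2 * dot D D) =
      (M - m) * dot D s + dot D D by field; rewrite gt_eqF.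
  by move: h; rewrite E1 E2; lra.
have -> : M - m = 0 by apply/eqP; rewrite subr_eq0 eq_le L0 m_le_M.
rewrite mul0r leNgt; apply/negP => D0.
have := key ((`|dot D s| + 1) / dot D D).
have -> : M - m = 0 by apply/eqP; rewrite subr_eq0 eq_le L0 m_le_M.
rewrite mulrA divfK ?gt_eqF // !mul0r addr0.
by have := ler_norm (dot D s); have := normr_ge0 (dot D s); lra.
Qed.

(** The intermediate value theorem finds the point where the slope along [p] has shrunk by the
    factor [b]. Convexity seen from that point gives the decrease, and the Lipschitz bound prevents
    a short step. *)
Lemma wolfe_step (b : R) x p : 0 < b -> b < 1 -> dot p (G x) < 0 ->
  exists a : R, [/\ 0 < a, dot p (G (x + a *: p)) = b * dot p (G x),
    phi (x + a *: p) <= phi x + a * (b * dot p (G x))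
  & (1 - b) * - dot p (G x) <= M * a * dot p p].
Proof.
move=> b0 b1 pG.
have p0 : p != 0 by apply: contraTneq pG => ->; rewrite dot0l ltxx.
have pp := dot_gt0 p0.
pose h (t : R) := dot p (G (x + t *: p)).
have h0 : h 0 = dot p (G x) by rewrite /h scale0r addr0.
have hlip (t t' : R) : t <= t' -> `|h t' - h t| <= M * (t' - t) * dot p p.
  move=> tt'; have := @gradient_diff_bound (x + t *: p) p (t' - t).
  rewrite subr_ge0 => /(_ tt'); rewrite -addrA -scalerDl addrCA subrr addr0.
  by rewrite /h -[X in `|X| <= _ -> _]dotC !dotlin.
have hcont : continuous h.
  move=> t; apply/cvgrPdist_le => e e0.
  have K0 : 0 < M * dot p p + 1 by rewrite ltr_wpDl // mulr_ge0 // ltW.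
  have r0 : 0 < e / (M * dot p p + 1) by rewrite divr_gt0.
  near=> u.
  have u1 : `|t - u| <= e / (M * dot p p + 1).
    by near: u; apply: (@cvgr_dist_le _ _ _ (nbhs t) _ id t); [exact: cvg_id|].
  have : `|h t - h u| <= M * `|t - u| * dot p p.
    have [tu|tu] := leP t u.
      by rewrite distrC (distrC t) (ger0_norm (_ : 0 <= u - t)) ?subr_ge0 // hlip.
    by rewrite (ger0_norm (_ : 0 <= t - u)) ?subr_ge0 ?hlip // ltW.
  move/le_trans; apply.
  rewrite ler_pdivlMr // in u1.
  by apply: le_trans u1; rewrite mulrDr mulr1 mulrAC mulrC ler_wpDr.
(* The slope grows at rate at least [m * dot p p] by strong monotonicity, so it is nonnegative at
   [T]. *)
pose T := - dot p (G x) / (m * dot p p).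
have mpp : 0 < m * dot p p by rewrite mulr_gt0.
have T0 : 0 < T by rewrite divr_gt0 // oppr_gt0.
have hT : 0 <= h T.
  have := gradient_strongly_monotone x (T *: p).
  rewrite !dotlin -mulrBr (mulrCA m) ler_pM2l // -dotC (dotC (G x)).
  have -> : m * (T * dot p p) = - dot p (G x) by rewrite /T; field; rewrite !gt_eqF.
  by rewrite /h; lra.
have [|a aT ha] := @IVT R h 0 T (b * dot p (G x)) (ltW T0) (continuous_subspaceT hcont).
  by rewrite ge_min le_max h0; apply/andP; split; apply/orP; [left|right]; nra.
have a0 : 0 < a.
  have : 0 <= a by move: aT; rewrite in_itv /= => /andP[].
  rewrite le_eqVlt => /orP[/eqP a0|//]; move: ha; rewrite -a0 h0 => ha.
  by nra.
exists a; split => //.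
- have := strong_convexity_lower (x + a *: p) (- (a *: p)).
  rewrite addrK !dotlin (dotC _ p) -/(h a) ha.
  have : 0 <= m / 2 * (a * (a * dot p p)) by rewrite !mulr_ge0 ?ltW ?divr_gt0.
  by rewrite !mulrN opprK; lra.
- have := hlip 0 a (ltW a0); rewrite ha h0 subr0 => /(le_trans _); apply.
  by apply: le_trans (ler_norm _); lra.
Unshelve. all: by end_near.
Qed.

(** The exact gradient difference lies within [L * enorm s] of [c *: s], with [c] the midpoint and
    [L] the half-width of [[m, M]]. As [enorm s >= l], the noise widens the radius by at most
    [e * enorm s], which turns [[m, M]] into [[m_hat, M_hat]]. *)
Lemma noisy_secant (g : 'cV[R]_d -> 'cV[R]_d) (eps l : R) x s :
  (forall z, enorm (g z - G z) <= eps) -> 0 < l -> l <= enorm s ->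
  m_hat m eps l * dot s s <= dot s (g (x + s) - g x) /\
  (0 <= m_hat m eps l ->
   dot (g (x + s) - g x) (g (x + s) - g x) <=
   M_hat M eps l * dot s (g (x + s) - g x)).
Proof.
move=> g_err l0 ls; set y := g (x + s) - g x.
have eps0 : 0 <= eps by apply: le_trans (g_err x); exact: enorm_ge0.
pose L := (M - m) / 2; pose c := (M + m) / 2; pose e := 2 * eps / l.
have L0 : 0 <= L by rewrite divr_ge0 // subr_ge0.
(* Since [M - m = 2 * L], cocoercivity says precisely that [D - L *: s] is no longer than
   [L *: s]. *)
have exact_bound : enorm (G (x + s) - G x - c *: s) <= L * enorm s.
  apply: enorm_le; first by rewrite mulr_ge0 ?enorm_ge0.
  rewrite exprMn sqr_enorm.
  have := gradient_cocoercive (x + s) x; rewrite /= [x + s - x]addrAC subrr add0r.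
  set D := _ - m *: s; have -> : G (x + s) - G x - c *: s = D - L *: s.
    by rewrite /D -[RHS]addrA -[in RHS]opprD -scalerDl /c /L; congr (_ - _ *: _); field.
  by clearbody D; rewrite !dotlin (dotC s D) /L => h; nra.
have yE : y - c *: s = (G (x + s) - G x - c *: s) +
    ((g (x + s) - G (x + s)) + (G x - g x)).
  by apply/colP => i; rewrite !mxE; ring.
clearbody y.
have e0 : 0 <= e by rewrite divr_ge0 ?mulr_ge0 // ltW.
have bound : enorm (y - c *: s) <= (L + e) * enorm s.
  rewrite yE mulrDl; apply: le_trans (enormD _ _) _; apply: lerD => //.
  apply: le_trans (enormD _ _) _; rewrite (enormB_sym (G x)).
  have := g_err x; have := g_err (x + s).
  have : 2 * eps <= e * enorm s by rewrite mulrAC ler_pdivlMr // ler_wpM2l // mulr_ge0.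
  lra.
have [lo hi] : - ((L + e) * dot s s) <= dot s (y - c *: s) /\
     dot s (y - c *: s) <= (L + e) * dot s s.
  have : enorm s * enorm (y - c *: s) <= (L + e) * dot s s.
    by rewrite -sqr_enorm expr2 mulrC mulrA ler_wpM2r ?enorm_ge0.
  have := dot_le_enorm s (y - c *: s); have := dot_ge_enorm s (y - c *: s); lra.
move: lo hi; rewrite !dotlin => lo hi.
have mE : m_hat m eps l = c - (L + e) by rewrite /m_hat /c /L /e; field; rewrite gt_eqF.
have ME : M_hat M eps l = c + (L + e) by rewrite /M_hat /c /L /e; field; rewrite gt_eqF.
rewrite mE ME; split; first by lra.
move=> mh0.
(* Expanded, this reads [|y|^2 <= (m_hat + M_hat) s.y - m_hat M_hat |s|^2]; with [m_hat >= 0] and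
   [s.y <= M_hat |s|^2] the bound follows. *)
have : dot (y - c *: s) (y - c *: s) <= (L + e) ^+ 2 * dot s s.
  by rewrite -!sqr_enorm -exprMn ler_pXn2r ?nnegrE ?mulr_ge0 ?enorm_ge0 ?addr_ge0.
rewrite !dotlin (dotC y s); nra.
Qed.

End Smooth.

(** * The Armijo-Wolfe line search under noise *)

Section LineSearch.
Local Set Implicit Arguments.
Local Unset Strict Implicit.
Context {R : realType} {d : nat} {phi f : 'cV[R]_d -> R} {g : 'cV[R]_d -> 'cV[R]_d}.
Context {m M eps_f eps_g c1 c2 : R}.
Hypothesis phi_diff : forall x, differentiable phi x.
Hypothesis m_gt0 : 0 < m.
Hypothesis m_le_M : m <= M.
Hypothesis phi_lip : elipschitz M (gradient phi).
Hypothesis phi_conv : strongly_convex m phi.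
Hypothesis f_error : forall z, `|f z - phi z| <= eps_f.
Hypothesis g_error : forall z, enorm (g z - gradient phi z) <= eps_g.
Hypothesis c1_gt0 : 0 < c1.
Hypothesis c1_lt_c2 : c1 < c2.
Hypothesis c2_lt1 : c2 < 1.
Implicit Types (x y z w p s : 'cV[R]_d).
Local Notation G := (gradient phi).

(** The radius of [N1] with a general angle bound [b] in place of [beta1]. *)
Definition noise_level (b : R) : R :=
  Num.max (constA c1 c2 * (Num.sqrt (M * eps_f) / b))
          (constB c1 c2 * (eps_g / b)).

Let M_gt0 : 0 < M. Proof. exact: lt_le_trans m_gt0 m_le_M. Qed.

Let eps_f_ge0 : 0 <= eps_f.
Proof. exact: le_trans (normr_ge0 _) (f_error 0). Qed.

Let eps_g_ge0 : 0 <= eps_g.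
Proof. exact: le_trans (enorm_ge0 _) (g_error 0). Qed.

Let K_gt0 : 0 < (c2 - c1) * (4 - c1 - 3 * c2).
Proof. by apply: mulr_gt0; have := c1_lt_c2; have := c2_lt1; lra. Qed.

(** Makes the decrease at each good iterate strictly positive. *)
Lemma noise_level_gt0 (b : R) : 0 < b -> 0 < Num.max eps_f eps_g ->
  0 < noise_level b.
Proof.
move=> b0; rewrite !lt_max => /orP[e0|e0]; apply/orP; [left|right].
- rewrite mulr_gt0 ?divr_gt0 ?sqrtr_gt0 ?mulr_gt0 //.
  by rewrite lt_max divr_gt0 // ?sqrtr_gt0 // mulr_gt0 // sqrtr_gt0.
- rewrite mulr_gt0 ?divr_gt0 //.
  by rewrite lt_max divr_gt0 ?subr_gt0.
Qed.

(** Clears roots and denominators from the constants, leaving inequalities suited to linear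
    arithmetic; 512 is the square of [16 * Num.sqrt 2]. *)
Lemma noise_levelP (b N : R) : 0 < b -> noise_level b < N ->
  [/\ 0 < N, 512 * (M * eps_f) <= (c2 - c1) * (4 - c1 - 3 * c2) * (b * N) ^+ 2,
   8 * eps_g <= (1 - c2) * (b * N) &
   (8 * (1 + c1) + 6 * (c2 - c1)) * eps_g <= (c2 - c1) * (b * N)].
Proof.
move=> b0; rewrite gt_max => /andP[hA hB].
have s0 : 0 <= Num.sqrt (M * eps_f) := sqrtr_ge0 _.
have K0 : 0 < Num.sqrt ((c2 - c1) * (4 - c1 - 3 * c2)) by rewrite sqrtr_gt0.
have A1 : 16 * Num.sqrt 2 / Num.sqrt ((c2 - c1) * (4 - c1 - 3 * c2)) <= constA c1 c2.
  by rewrite le_max lexx.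
have B1 : 8 / (1 - c2) <= constB c1 c2 by rewrite le_max lexx.
have B2 : 8 * (1 + c1) / (c2 - c1) + 6 <= constB c1 c2 by rewrite le_max lexx orbT.
have d1 : 0 < 1 - c2 by rewrite subr_gt0.
have d2 : 0 < c2 - c1 by rewrite subr_gt0.
rewrite mulrA ltr_pdivrMr // (mulrC N) in hA.
rewrite mulrA ltr_pdivrMr // (mulrC N) in hB.
have hB1 : 8 / (1 - c2) * eps_g <= b * N.
  by apply: le_trans (ltW hB); rewrite ler_wpM2r.
have hB2 : (8 * (1 + c1) / (c2 - c1) + 6) * eps_g <= b * N.
  by apply: le_trans (ltW hB); rewrite ler_wpM2r.
have hA1 : 16 * Num.sqrt 2 / Num.sqrt ((c2 - c1) * (4 - c1 - 3 * c2)) *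
    Num.sqrt (M * eps_f) <= b * N.
  by apply: le_trans (ltW hA); rewrite ler_wpM2r.
have bN : 0 < b * N.
  by apply: le_lt_trans hB; rewrite mulr_ge0 // le_max divr_ge0 // ltW.
split.
- by rewrite -(pmulr_rgt0 _ b0).
- have : 16 * Num.sqrt 2 * Num.sqrt (M * eps_f) <=
      Num.sqrt ((c2 - c1) * (4 - c1 - 3 * c2)) * (b * N).
    by rewrite -ler_pdivrMl // mulrCA mulrA.
  have e0 : 0 <= M * eps_f by rewrite mulr_ge0 // ltW.
  set L := 16 * _ * _; set U := _ * (b * N) => LU.
  have L0 : 0 <= L by rewrite !mulr_ge0 ?sqrtr_ge0.
  have : L ^+ 2 <= U ^+ 2 by rewrite lerXn2r // nnegrE // (le_trans L0).
  rewrite [X in X <= _]exprMn [X in _ <= X]exprMn exprMn.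
  by rewrite !sqr_sqrtr // ?(ltW K_gt0) //; lra.
- by move: hB1; rewrite mulrAC ler_pdivrMr // [_ * (1 - c2)]mulrC.
- move: hB2; rewrite -(ler_pM2l d2); apply: le_trans.
  by rewrite le_eqVlt; apply/orP; left; apply/eqP; field; rewrite gt_eqF.
Qed.

Let dot_g_error p z :
  `|dot p (g z) - dot p (G z)| <= eps_g * enorm p.
Proof.
rewrite -[X in `|X|](_ : dot p (g z - G z) = _); last by rewrite !dotlin.
have h : enorm p * enorm (g z - G z) <= eps_g * enorm p.
  by rewrite mulrC ler_wpM2r ?enorm_ge0.
rewrite ler_norml.
have := dot_ge_enorm p (g z - G z); have := dot_le_enorm p (g z - G z).
by move=> *; apply/andP; split; lra.
Qed.

Let enorm_g_lower z : enorm (G z) - eps_g <= enorm (g z).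
Proof.
have := enormD (g z) (G z - g z); rewrite subrKC enormB_sym.
by have := g_error z; lra.
Qed.

(** The exact step is taken for the slope factor [(c1 + 3 * c2) / 4], strictly between [c1] and
    [c2]. The gaps to [c1] and [c2] absorb the gradient noise, and the resulting step is long enough
    to absorb the noise in [f]. *)
Lemma armijo_wolfe_exists (b : R) x p : 0 < b -> b <= 1 -> p != 0 ->
  b * (enorm p * enorm (g x)) <= - dot p (g x) -> noise_level b < enorm (G x) ->
  exists a, armijo_wolfe f g c1 c2 x p a.
Proof.
move=> b0 b1 p0 angle /(noise_levelP b0)[N0 hA hB1 hB2].
have [hc1 hc12 hc2 eg0] := And4 c1_gt0 c1_lt_c2 c2_lt1 eps_g_ge0.
have P0 := enorm_gt0 p0.
have d2 : 0 < c2 - c1 by rewrite subr_gt0.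
set N := enorm (G x) in N0 hA hB1 hB2 *; set P := enorm p in angle P0 *.
(* The exact rate of descent per unit length along [p]. *)
pose gam := - dot p (G x) / P.
have pG : dot p (G x) = - (gam * P) by rewrite divfK ?gt_eqF // opprK.
have bN0 : 0 < b * N by rewrite mulr_gt0.
have be : b * eps_g <= eps_g by rewrite ler_piMl.
have gam1 : b * N - 2 * eps_g <= gam.
  rewrite /gam ler_pdivlMr //.
  have := dot_g_error p x; rewrite ler_norml => /andP[h1 _]; rewrite -/P in h1.
  have h2 : b * (P * (N - eps_g)) <= b * (P * enorm (g x)).
    by rewrite !ler_pM2l // enorm_g_lower.
  have h3 : b * eps_g * P <= eps_g * P by rewrite ler_pM2r.
  have -> : (b * N - 2 * eps_g) * P =
      b * (P * (N - eps_g)) + b * eps_g * P - 2 * (eps_g * P) by ring.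
  lra.
clearbody gam.
have e8 : 8 * eps_g <= b * N.
  by apply: le_trans hB1 _; rewrite ler_piMl ?(ltW bN0) //; lra.
have gam2 : 3 / 4 * (b * N) <= gam by lra.
have c2gam : (8 + 4 * c1 + 4 * c2) * eps_g <= (c2 - c1) * gam.
  have : (c2 - c1) * (b * N - 2 * eps_g) <= (c2 - c1) * gam by rewrite ler_pM2l.
  lra.
have ce1 : c1 * eps_g <= eps_g by rewrite ler_piMl //; lra.
have ce2 : 0 <= c1 * eps_g by rewrite mulr_ge0 // ltW.
have ce3 : c1 * eps_g <= c2 * eps_g by rewrite ler_wpM2r // ltW.
have bN1 : 0 < gam by lra.
have pG0 : dot p (G x) < 0 by rewrite pG oppr_lt0 mulr_gt0.
have [||a [a0 ha1 ha2 ha3]] := @wolfe_step _ _ _ _ _ phi_diff m_gt0 m_le_M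
  phi_lip phi_conv ((c1 + 3 * c2) / 4) x p _ _ pG0; [lra|lra|].
have aP : (4 - c1 - 3 * c2) / 4 * gam <= M * (a * P).
  move: ha3; rewrite -sqr_enorm -/P pG opprK => ha3.
  rewrite -(ler_pM2r P0); lra.
exists a; split => //.
- have h1 := f_error x; have h2 := f_error (x + a *: p).
  move: h1 h2; rewrite !ler_norml => /andP[h1 _] /andP[_ h2].
  have := dot_g_error p x; rewrite ler_norml => /andP[h3 _]; rewrite -/P in h3.
  have h4 : c1 * a * - (gam * P + eps_g * P) <= c1 * a * dot p (g x).
    by rewrite ler_pM2l ?mulr_gt0 //; lra.
  rewrite pG in ha2.
  have aP0 : 0 < a * P by rewrite mulr_gt0.
  (* The surplus slope is [3 / 4 * (c2 - c1) * gam]; a third of it covers the gradient noise. *)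
  have h5 : a * P * ((c2 - c1) * gam / 2) <=
      a * P * ((c1 + 3 * c2) / 4 * gam - c1 * gam - c1 * eps_g).
    by rewrite ler_pM2l //; lra.
  (* The other two thirds cover the errors of [f] at both ends of the step, by the lower bound [aP]
     on its length. *)
  have h6 : 2 * eps_f <= a * P * ((c2 - c1) * gam / 2).
    rewrite -(ler_pM2l M_gt0).
    have q0 : 0 <= (c2 - c1) * gam / 2 by rewrite divr_ge0 // mulr_ge0 // ltW.
    have h7 := ler_wpM2r q0 aP.
    have h8 : (3 / 4 * (b * N)) ^+ 2 <= gam ^+ 2.
      by rewrite lerXn2r // nnegrE; lra.
    have Me0 : 0 <= M * eps_f by rewrite mulr_ge0 // ltW.
    have h9 := ler_wpM2l (ltW K_gt0) h8.
    lra.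
  lra.
- have := dot_g_error p x; rewrite ler_norml => /andP[_ h3]; rewrite -/P in h3.
  have := dot_g_error p (x + a *: p); rewrite ler_norml => /andP[h4 _].
  rewrite -/P ha1 in h4.
  have c20 : 0 < c2 by lra.
  have h5 : c2 * dot p (g x) <= c2 * (- (gam * P) + eps_g * P).
    by rewrite ler_pM2l //; lra.
  (* The gap from [(c1 + 3 * c2) / 4] to [c2] pays for the gradient noise at both ends of the
     step. *)
  have : (1 + c2) * eps_g * P <= (c2 - c1) * gam / 4 * P.
    by rewrite ler_pM2r //; lra.
  rewrite pG in h4; lra.
Qed.

(** The curvature condition and the Lipschitz bound force [a * enorm p] to be at least
    [(1 - c2) * (b * N) / (2 * M)], and the Armijo condition gains at least [c1 * (b * N) / 2] per
    unit length, with [N] the norm of the exact gradient. *)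
Lemma armijo_wolfe_decrease (b : R) x p a :
  0 < b -> b <= 1 -> 0 <= noise_level b -> p != 0 ->
  b * (enorm p * enorm (g x)) <= - dot p (g x) -> noise_level b < enorm (G x) ->
  armijo_wolfe f g c1 c2 x p a ->
  f (x + a *: p) <= f x - c1 * (1 - c2) * (b * noise_level b) ^+ 2 / (4 * M).
Proof.
move=> b0 b1 t0 p0 angle tN [a0 dec wolfe].
have [N0 _ hB1 _] := noise_levelP b0 tN.
have [hc1 hc12 hc2 eg0] := And4 c1_gt0 c1_lt_c2 c2_lt1 eps_g_ge0.
have P0 := enorm_gt0 p0.
set N := enorm (G x) in tN N0 hB1 *; set P := enorm p in angle P0 *.
have bN0 : 0 < b * N by rewrite mulr_gt0.
have be : b * eps_g <= eps_g by rewrite ler_piMl.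
have e8 : 8 * eps_g <= b * N.
  by apply: le_trans hB1 _; rewrite ler_piMl ?(ltW bN0) //; lra.
have pgl : P * (b * N / 2) <= P * (b * N - b * eps_g) by rewrite ler_pM2l //; lra.
have pg : P * (b * N - b * eps_g) <= - dot p (g x).
  apply: le_trans angle.
  have -> : P * (b * N - b * eps_g) = b * (P * (N - eps_g)) by ring.
  by rewrite !ler_pM2l // enorm_g_lower.
have aP : (1 - c2) * (b * N) / 2 <= M * (a * P).
  have := dot_g_error p x; rewrite ler_norml => /andP[h1 _]; rewrite -/P in h1.
  have := dot_g_error p (x + a *: p); rewrite ler_norml => /andP[_ h2].
  rewrite -/P in h2.
  have := gradient_diff_bound phi_lip x p (ltW a0).
  rewrite -sqr_enorm -/P ler_norml dotC !dotlin => /andP[_ h3].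
  have c20 : 0 <= 1 - c2 by lra.
  have h4 := ler_wpM2l c20 pg.
  rewrite -(ler_pM2r P0).
  have h5 : P * (8 * eps_g) <= P * ((1 - c2) * (b * N)) by rewrite ler_pM2l.
  have h6 : P * ((1 - c2) * (b * eps_g)) <= P * ((1 - c2) * (b * N / 8)).
    by rewrite ler_pM2l // ler_pM2l; lra.
  have h7 : 0 <= (1 - c2) * (b * N) * P.
    by rewrite mulr_ge0 ?(ltW P0) // mulr_ge0 // ltW.
  lra.
apply: le_trans dec _; rewrite -subr_ge0.
have h1 : c1 * a * (P * (b * N / 2)) <= c1 * a * - dot p (g x).
  by rewrite ler_pM2l ?mulr_gt0 // (le_trans pgl).
suff : c1 * (1 - c2) * (b * noise_level b) ^+ 2 / (4 * M) <=
  c1 * a * (P * (b * N / 2)) by lra.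
rewrite ler_pdivrMr ?mulr_gt0 //.
have sq : (b * noise_level b) ^+ 2 <= (b * N) ^+ 2.
  by rewrite lerXn2r ?nnegrE ?(ltW bN0) ?mulr_ge0 ?(ltW b0) // ler_pM2l // ltW.
have k0 : 0 <= c1 * (1 - c2) by rewrite mulr_ge0 ?subr_ge0 // ltW.
have h2 := ler_wpM2l k0 sq.
have k1 : 0 <= c1 * (b * N) by rewrite mulr_ge0 // ltW.
have h3 := ler_wpM2l k1 aP.
lra.
Qed.

End LineSearch.

(** * Lengthened steps *)

Section Trace.
Local Set Implicit Arguments.
Local Unset Strict Implicit.
Context {R : realType} {d : nat}.
Implicit Types (p s : 'cV[R]_d).

(** Lengthening preserves the direction; a failed search, [a = 0], falls in the second branch
    because [0 < l]. *)
Lemma lengthened_step_scale (l a : R) p : 0 < l -> 0 <= a -> p != 0 ->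
  exists2 c : R, 0 < c & lengthened_step l a p = c *: p.
Proof.
move=> l0 a0 p0; rewrite /lengthened_step; case: ifP => la; last first.
  by exists (l / enorm p); rewrite // divr_gt0 // enorm_gt0.
exists a => //; move: la; rewrite enormZ ger0_norm // => la.
by rewrite -(pmulr_lgt0 _ (enorm_gt0 p0)) (lt_le_trans l0).
Qed.

Lemma lengthened_step_norm (l a : R) p : 0 < l -> p != 0 ->
  l <= enorm (lengthened_step l a p).
Proof.
move=> l0 p0; rewrite /lengthened_step; case: ifP => // _.
rewrite enormZ ger0_norm ?divr_ge0 ?enorm_ge0 ?(ltW l0) //.
by rewrite divfK // gt_eqF // enorm_gt0.
Qed.

Lemma line_search_ge0 (f : 'cV[R]_d -> R) g (c1 c2 : R) x p a :
  line_search f g c1 c2 x p a -> 0 <= a.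
Proof. by case=> [[/ltW]|[_ ->]]. Qed.

End Trace.

(** * Positive definiteness, potential and angles along the method *)

Section BFGS.
Local Set Implicit Arguments.
Local Unset Strict Implicit.
Context {R : realType} {d : nat} {phi f : 'cV[R]_d -> R} {g : 'cV[R]_d -> 'cV[R]_d}.
Context {m M eps_g c1 c2 l : R} {x0 : 'cV[R]_d} {H0 : 'M[R]_d}.
Context {x p s y : nat -> 'cV[R]_d} {alpha : nat -> R} {H : nat -> 'M[R]_d}.
Hypothesis phi_diff : forall x, differentiable phi x.
Hypothesis m_gt0 : 0 < m.
Hypothesis m_le_M : m <= M.
Hypothesis phi_lip : elipschitz M (gradient phi).
Hypothesis phi_conv : strongly_convex m phi.
Hypothesis g_error : forall z, enorm (g z - gradient phi z) <= eps_g.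
Hypothesis l_gt0 : 0 < l.
Hypothesis l_large : 2 * eps_g / m < l.
Hypothesis H0_posdef : sym_posdef H0.
Hypothesis trace : bfgs_trace f g c1 c2 l x0 H0 x p s y alpha H.

(** Defined by the direct update instead of as [invmx (H k)], so that the trace and determinant
    formulas apply to it; [hessian_approxP] shows that it inverts [H k]. *)
Fixpoint hessian_approx (k : nat) : 'M[R]_d :=
  if k is k'.+1 then bfgs_update_inv (hessian_approx k') (s k') (y k')
  else invmx H0.
Local Notation B := hessian_approx.
Local Notation psi k := (\tr (B k) - ln (\det (B k))).
Local Notation mh := (m_hat m eps_g l).
Local Notation Mh := (M_hat M eps_g l).

Lemma m_hat_gt0 : 0 < mh.
Proof.
by rewrite /m_hat subr_gt0 ltr_pdivrMr // (mulrC m) -ltr_pdivrMr.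
Qed.

(** The inverse relation is a hypothesis because this is needed inside the induction that
    establishes it. *)
Lemma direction_neq0 k : H k *m B k = 1%:M ->
  p k != 0 /\ g (x k) = - (B k *m p k).
Proof.
move=> HB; have BH := mulmx1C HB.
have gE : g (x k) = - (B k *m p k).
  by rewrite (bfgs_dir trace) mulmxN opprK mulmxA BH mul1mx.
split=> //; apply: contraTneq (bfgs_g_neq0 trace k) => p0.
by rewrite negbK gE p0 mulmx0 oppr0.
Qed.

Lemma secant_bounds k : p k != 0 ->
  [/\ s k != 0, mh * dot (s k) (s k) <= dot (s k) (y k) &
      dot (y k) (y k) <= Mh * dot (s k) (y k)].
Proof.
move=> p0; have ls : l <= enorm (s k).
  by rewrite (bfgs_s trace) lengthened_step_norm.
have [h1 h2] := noisy_secant phi_diff m_gt0 m_le_M phi_lip phi_conv (x k)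
  g_error l_gt0 ls.
rewrite (bfgs_y trace); split => //; last exact/h2/ltW/m_hat_gt0.
apply: contraTneq ls => ->.
by rewrite -ltNge /enorm dot0l sqrtr0.
Qed.

(** The two claims are proved together: invertibility makes [p k] nonzero, hence [s k] nonzero and
    [dot (s k) (y k)] positive, which the next update requires. *)
Lemma hessian_approxP k : sym_posdef (B k) /\ H k *m B k = 1%:M.
Proof.
elim: k => [|k [BP HB]] /=.
  rewrite (bfgs_H0 trace) mulmxV; first by split=> //; exact: sym_posdef_invmx.
  by have [dH _] := sym_posdef_trace_ln_det H0_posdef; rewrite unitmxE unitfE gt_eqF.
have [p0 _] := direction_neq0 HB.
have [s0 ms My] := secant_bounds p0.
have sb := BP.2 _ s0.
have sy : 0 < dot (s k) (y k).
  by apply: lt_le_trans ms; rewrite mulr_gt0 ?m_hat_gt0 ?dot_gt0.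
split; first by have [] := bfgs_update_inv_posdef BP sy sb.
by rewrite (bfgs_H trace) bfgs_update_invP ?BP.1 ?gt_eqF.
Qed.

Lemma bfgs_descent k : dot (p k) (g (x k)) < 0.
Proof.
have [BP HB] := hessian_approxP k; have [p0 ->] := direction_neq0 HB.
by rewrite dotNr oppr_lt0 BP.2.
Qed.

(** Since [s k] is a positive multiple of [p k] and [B k *m p k = - g (x k)], the angle between [s]
    and [B s] is the one between [p] and [- g]. *)
Lemma psi_step k : psi k.+1 <= psi k + (Mh - 1 - ln mh) +
  ln (dot (p k) (g (x k)) ^+ 2 /
      (dot (p k) (p k) * dot (g (x k)) (g (x k)))).
Proof.
have [BP HB] := hessian_approxP k; have [p0 gE] := direction_neq0 HB.
have [s0 ms My] := secant_bounds p0.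
have := bfgs_update_inv_trace_ln_det BP s0 m_hat_gt0 ms My.
have [c c0 sE] := lengthened_step_scale l_gt0 (line_search_ge0 (bfgs_alpha trace k)) p0.
rewrite -(bfgs_s trace) in sE; move/le_trans; apply; rewrite lerD2l.
rewrite gE sE -scalemxAr !dotlin opprK.
have pp := dot_gt0 p0.
have bb : 0 < dot (B k *m p k) (B k *m p k).
  by rewrite -[X in 0 < X]opprK -dotNl -dotNr -gE dot_gt0 // (bfgs_g_neq0 trace).
rewrite le_eqVlt; apply/orP; left; apply/eqP; congr ln.
by field; rewrite !gt_eqF.
Qed.

Let eps_g_ge0 : 0 <= eps_g.
Proof. exact: le_trans (enorm_ge0 _) (g_error 0). Qed.

Lemma m_hat_le_M_hat : mh <= Mh.
Proof.
have e0 : 0 <= 2 * eps_g / l by rewrite divr_ge0 ?mulr_ge0 // ltW.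
by have := m_le_M; rewrite /m_hat /M_hat; lra.
Qed.

(** The initial potential is at least [d], and [(1 - q)^-1] exceeds 1. The margin of 1 becomes the
    loss of potential at each bad iterate. *)
Lemma beta0_lower (q : R) : 0 < q -> q < 1 ->
  0 <= Mh - 1 - ln mh /\ Mh - 1 - ln mh + 1 <= beta0 m M eps_g l q H0.
Proof.
move=> q0 q1.
have c0 : 0 <= Mh - 1 - ln mh.
  have := @le_ln1Dx R (mh - 1); rewrite addrCA subrr addr0.
  by have := m_hat_gt0; have := m_hat_le_M_hat => h1 h2 /(_ _); lra.
split=> //.
(* A nonzero vector [g (x 0)] excludes dimension 0. *)
have d1 : 1 <= d%:R :> R.
  rewrite ler1n lt0n; apply: contraNneq (bfgs_g_neq0 trace 0) => d0.
  by apply/eqP/colP => -[i id]; exfalso; rewrite d0 in id.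
have [_ psi0] := sym_posdef_trace_ln_det (sym_posdef_invmx H0_posdef).
rewrite /beta0 -ler_pdivrMl ?invr_gt0 ?subr_gt0 // invrK.
have : (1 - q) * (Mh - 1 - ln mh + 1) <= Mh - 1 - ln mh + 1.
  by rewrite ler_piMl //; lra.
lra.
Qed.

(* If the cosine stayed below [beta1], each update would lower
   [\tr B - ln (\det B)] by at least 1, but this quantity is nonnegative. *)
Lemma bfgs_good_angle_infinite (q : R) : 0 < q -> q < 1 -> forall n : nat,
  exists2 k, (n <= k)%N &
    beta1 m M eps_g l q H0 * (enorm (p k) * enorm (g (x k))) <=
    - dot (p k) (g (x k)).
Proof.
move=> q0 q1 n; apply: contrapT => bad.
have [_ b1] := beta0_lower q0 q1.
have step k : (n <= k)%N -> psi k.+1 <= psi k - 1.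
  move=> nk; apply: le_trans (psi_step k) _.
  have : ~ (beta1 m M eps_g l q H0 * (enorm (p k) * enorm (g (x k))) <=
            - dot (p k) (g (x k))).
    by move=> ?; apply: bad; exists k.
  move/negP; rewrite -ltNge => lt.
  have [p0 _] := direction_neq0 (hessian_approxP k).2.
  have pg := bfgs_descent k.
  have den : 0 < dot (p k) (p k) * dot (g (x k)) (g (x k)).
    by rewrite mulr_gt0 ?dot_gt0 ?(bfgs_g_neq0 trace).
  (* [r] is the squared cosine, and [beta1] squared is [expR (- beta0)]. *)
  set r := _ / _; have : r <= expR (- beta0 m M eps_g l q H0).
    rewrite ler_pdivrMr // -sqrrN.
    have -> : expR (- beta0 m M eps_g l q H0) = beta1 m M eps_g l q H0 ^+ 2.
      by rewrite expr2 -expRD; congr expR; field.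
    rewrite -!sqr_enorm -!exprMn; apply: lerXn2r;
      rewrite ?nnegrE ?oppr_ge0 ?(ltW pg) ?(ltW lt) //.
    by rewrite !mulr_ge0 ?enorm_ge0 // expR_ge0.
  have r0 : 0 < r by rewrite divr_gt0 // exprn_even_gt0 //= lt_eqF.
  move=> rb; have : ln r <= ln (expR (- beta0 m M eps_g l q H0)).
    by rewrite ler_ln // posrE // expR_gt0.
  by rewrite expRK; lra.
have dec j : psi (n + j)%N <= psi n - j%:R.
  elim: j => [|j IH]; first by rewrite addn0 subr0.
  rewrite addnS; apply: le_trans (step _ (leq_addr _ _)) _; rewrite -natr1; lra.
have psi_ge0 k : 0 <= psi k.
  have [_] := sym_posdef_trace_ln_det (hessian_approxP k).1.
  exact: le_trans.
have := archi_boundP (psi_ge0 n); have := dec (Num.bound (psi n)).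
have := psi_ge0 (n + Num.bound (psi n))%N; lra.
Qed.

Lemma bfgs_monotone k : 0 < c1 -> f (x k.+1) <= f (x k).
Proof.
move=> c10; rewrite (bfgs_x trace).
case: (bfgs_alpha trace k) => [[a0 dec _]|[_ ->]]; last by rewrite scale0r addr0.
apply: le_trans dec _; rewrite gerDl pmulr_rle0 ?mulr_gt0 //.
exact: ltW (bfgs_descent k).
Qed.

End BFGS.

(** * Unbounded decrease of [f] if no iterate lies in [N1] *)

Theorem theorem3p17 (R : realType) (d : nat)
    (phi f : 'cV[R]_d -> R) (g : 'cV[R]_d -> 'cV[R]_d)
    (m M eps_f eps_g c1 c2 l q : R)
    (x0 : 'cV[R]_d) (H0 : 'M[R]_d)
    (x p s y : nat -> 'cV[R]_d) (alpha : nat -> R) (H : nat -> 'M[R]_d)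
    (phi_bounded_below : has_lbound (range phi))
    (phi_C2 : twice_continuously_differentiable phi)
    (m_gt0 : 0 < m) (m_le_M : m <= M) (M_gt0 : 0 < M)
    (phi_lipschitz : elipschitz M (gradient phi))
    (phi_strongly_convex : strongly_convex m phi)
    (eps_f_ge0 : 0 <= eps_f) (eps_g_ge0 : 0 <= eps_g)
    (f_error : forall z, `|f z - phi z| <= eps_f)
    (g_error : forall z, enorm (g z - gradient phi z) <= eps_g)
    (c1_gt0 : 0 < c1) (c1_lt_c2 : c1 < c2) (c2_lt1 : c2 < 1)
    (l_gt0 : 0 < l) (l_large : 2 * eps_g / m < l)
    (H0_posdef : sym_posdef H0)
    (trace : bfgs_trace f g c1 c2 l x0 H0 x p s y alpha H)
    (q_gt0 : 0 < q) (q_lt1 : q < 1)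
    (eps_gt0 : 0 < Num.max eps_f eps_g) :
  (hitting_time x (N1 phi m M eps_f eps_g c1 c2 l q H0) < +oo :> \bar R)%E.
Proof.
set N := N1 _ _ _ _ _ _ _ _ _ _.
have [[k Nk]|never] := pselect (exists k, N (x k)).
  by apply: le_lt_trans (ltry k%:R); apply: ereal_inf_lbound; exists k.
exfalso.
have phi_diff : forall z, differentiable phi z by case: phi_C2.
have good := bfgs_good_angle_infinite phi_diff m_gt0 m_le_M phi_lipschitz phi_strongly_convex
  g_error l_gt0 l_large H0_posdef trace q_gt0 q_lt1.
have descent := bfgs_descent phi_diff m_gt0 m_le_M phi_lipschitz phi_strongly_convex
  g_error l_gt0 l_large H0_posdef trace.
set b := beta1 m M eps_g l q H0 in good *.
have b0 : 0 < b by exact: expR_gt0.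
have b1 : b <= 1.
  have [] := beta0_lower m_gt0 m_le_M g_error l_gt0 l_large H0_posdef trace
    q_gt0 q_lt1.
  by rewrite expR_le1; lra.
have far k : @noise_level R M eps_f eps_g c1 c2 b < enorm (gradient phi (x k)).
  by rewrite ltNge; apply/negP => h; apply: never; exists k.
pose t := @noise_level R M eps_f eps_g c1 c2 b.
have t0 : 0 < t by exact: (noise_level_gt0 m_gt0 m_le_M c1_lt_c2 c2_lt1 b0 eps_gt0).
pose eta := c1 * (1 - c2) * (b * t) ^+ 2 / (4 * M).
have eta0 : 0 < eta by rewrite divr_gt0 ?mulr_gt0 ?exprn_gt0 ?mulr_gt0 ?subr_gt0.
have fmono k : f (x k.+1) <= f (x k).
  exact: (bfgs_monotone phi_diff m_gt0 m_le_M phi_lipschitz phi_strongly_convex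
            g_error l_gt0 l_large H0_posdef trace).
have mono n k : (n <= k)%N -> f (x k) <= f (x n).
  elim: k => [|k IH]; first by rewrite leqn0 => /eqP ->.
  rewrite leq_eqVlt => /orP[/eqP -> //|/IH]; apply: le_trans.
  exact: fmono.
(* Each good iterate beyond the previous index lowers [f] by [eta]; monotonicity covers the iterates
   in between. *)
have drop j : exists n, f (x n) <= f (x 0%N) - j%:R * eta.
  elim: j => [|j [n IH]]; first by exists 0%N; rewrite mul0r subr0.
  have [k nk angle] := good n.
  exists k.+1.
  have p0 : p k != 0.
    have := descent k.
    by apply: contraTneq => ->; rewrite dot0l ltxx.
  have aw : armijo_wolfe f g c1 c2 (x k) (p k) (alpha k).
    case: (bfgs_alpha trace k) => [//|[[]]].
    exact: (armijo_wolfe_exists phi_diff m_gt0 m_le_M phi_lipschitz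
              phi_strongly_convex f_error g_error c1_gt0 c1_lt_c2 c2_lt1
              b0 b1 p0 angle (far k)).
  have := armijo_wolfe_decrease m_gt0 m_le_M phi_lipschitz f_error g_error
    c1_gt0 c1_lt_c2 c2_lt1 b0 b1 (ltW t0) p0 angle (far k) aw.
  rewrite -(bfgs_x trace) -/t -/eta -natr1 mulrDl mul1r.
  have := mono n k nk; lra.
have [z zP] := phi_bounded_below.
have f_lower k : z - eps_f <= f (x k).
  have := zP (phi (x k)) (imageT _ _); have := f_error (x k).
  by rewrite ler_norml => /andP[]; lra.
(* More than [w] drops would push [f] below its lower bound [z - eps_f]. *)
pose w := (f (x 0%N) - z + eps_f) / eta.
have w0 : 0 <= w by rewrite divr_ge0 ?(ltW eta0) //; have := f_lower 0%N; lra.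
have [n] := drop (Num.bound w).
have := archi_boundP w0; rewrite ltr_pdivrMr //; have := f_lower n; lra.
Qed.
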